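(* Let $\mathbf a=(a_n)_{n\in\mathbb{N}}$ be an increasing sequence of integers and let $\psi:\mathbb{N}\to\mathbb{R}_{\geq 0}$ be any function (no monotonicity assumed) with $\sum_{n=1}^\infty\psi(n)=\infty$. Then for Lebesgue-almost every $\alpha\in[0,1]$, the set \[W(\psi,\mathbf a,\alpha)=\{\gamma\in[0,1] : \lVert a_n\alpha-\gamma\rVert<\psi(n)\text{ for infinitely many } n\}\] has Lebesgue measure $1$.
   Context: $\lVert x\rVert$ denotes the distance from the real number $x$ to the nearest integer. *)

(* Defs.v *)
From HB Require Import structures.
From mathcomp Require Import all_boot all_order all_algebra.
From mathcomp Require Import all_classical all_reals all_analysis.
Set Implicit Arguments.
Unset Strict Implicit.
Unset Printing Implicit Defensive.
Import Order.TTheory GRing.Theory Num.Theory.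
Local Open Scope classical_set_scope.
Local Open Scope ring_scope.

Definition dist_int (R : realType) (x : R) : R :=
  inf [set `|x - m%:~R| | m in [set: int]].

(* Sequences are indexed by the positive integers; values at 0 are ignored. *)
Definition W (R : realType) (psi : nat -> R) (a : nat -> int) (alpha : R) :
    set R :=
  [set gamma | gamma \in `[0, 1] /\
    infinite_set
      [set n | (1 <= n)%N /\ dist_int ((a n)%:~R * alpha - gamma) < psi n]].

(* Main.v *)
Require Import Defs.
From HB Require Import structures.
From mathcomp Require Import all_boot all_order all_algebra.
From mathcomp Require Import all_classical all_reals all_analysis.
From mathcomp Require Import measurable_realfun ring lra.
Set Implicit Arguments.
Unset Strict Implicit.
Unset Printing Implicit Defensive.
Import Order.TTheory GRing.Theory Num.Theory.
Import numFieldNormedType.Exports.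
Local Open Scope classical_set_scope.
Local Open Scope ring_scope.

(* Draw [(alpha, gamma)] uniformly in the unit square.  Since the [a n] are
   distinct, the endomorphism [(a m alpha - gamma, a n alpha - gamma)] of the
   2-torus has nonzero determinant and preserves the measure, so the events
   [dist_int (a n alpha - gamma) < psi n] are pairwise independent.  Their
   probabilities are at least [min (psi n) 1], whose sum diverges; the second
   Borel-Cantelli lemma only needs pairwise independence (Chebyshev), hence almost
   every pair lies in infinitely many of them, and Fubini concludes. *)

Lemma integral_cst_probability d (T : measurableType d) (R : realType)
  (P : probability T R) (r : \bar R) : (\int[P]_x r)%E = r.
Proof.
rewrite integral_cst// -[RHS]mule1; congr (_ * _)%E.
exact: probability_setT.
Qed.

(** * Translations and integer dilations of the circle *)

Section translation.
Context {R : realType}.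
Local Notation mu := (@lebesgue_measure R).
Local Open Scope ereal_scope.

Lemma measurable_addr (c : R) : measurable_fun [set: R] (fun x => x + c)%R.
Proof. by apply: measurable_funD. Qed.

(** Translation preserves the length of half-open intervals, and Lebesgue measure is the only
    measure that gives them their length. *)
Lemma lebesgue_measure_translate (c : R) (A : set R) : measurable A ->
  pushforward mu (fun x : measurableTypeR R => (x + c)%R : measurableTypeR R) A
  = mu A.
Proof.
move=> mA; have mf : @measurable_fun _ _ (measurableTypeR R) (measurableTypeR R)
  setT (fun x => x + c)%R := measurable_addr c.
(* Bundling the map with its measurability makes its pushforward a measure, to which uniqueness
   applies. *)
pose f : {mfun measurableTypeR R >-> measurableTypeR R} :=
  HB.pack (fun x : measurableTypeR R => (x + c)%R : measurableTypeR R)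
    (isMeasurableFun.Build _ _ _ _ _ mf).
apply/esym; apply: (@lebesgue_measure_unique R (pushforward mu f)) => //.
move=> _ [[a b]] _ <-; rewrite /pushforward/=.
rewrite [X in _ = mu X](_ : _ = `](a - c)%R, (b - c)%R]%classic); last first.
  by apply/seteqP; split => x/=; rewrite !in_itv/= ltrBlDr lerBrDr.
rewrite !lebesgue_measure_itv/= !lte_fin ltrD2r.
by case: ifPn => // _; rewrite -!EFinB opprB addrA subrK.
Qed.

(** Change of variables along the translation. The intervals are half-open so that they can later be
    cut and glued without overlap. *)
Lemma ge0_integral_translate (c u v : R) (f : R -> \bar R) :
  measurable_fun setT f -> (forall x, 0 <= f x) ->
  \int[mu]_(x in `[u, v[) f (x + c)%R =
  \int[mu]_(x in `[(u + c)%R, (v + c)%R[) f x.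
Proof.
move=> mf f0.
pose g (x : measurableTypeR R) := (x + c)%R : measurableTypeR R.
have -> : `[u, v[%classic = g @^-1` `[(u + c)%R, (v + c)%R[%classic.
  by apply/seteqP; split => x/=; rewrite !in_itv/= lerD2r ltrD2r.
rewrite -(@ge0_integral_pushforward _ _ _ _ R g (measurable_addr c) mu _ f)//;
  last first.
  exact: measurable_funTS.
apply: eq_measure_integral; first exact: measurable_addr.
by move=> mg A mA _; exact: lebesgue_measure_translate.
Qed.

Local Notation U := (uniform_prob (@ltr01 R)).

Lemma integral_uniform01 (f : R -> \bar R) :
  measurable_fun setT f -> (forall x, 0 <= f x) ->
  \int[U]_x f x = \int[mu]_(x in `[0%R, 1%R[) f x.
Proof.
move=> mf f0; rewrite integral_uniform// subr0 invr1 mul1e.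
by rewrite integral_itv_bndo_bndc//; exact: measurable_funTS.
Qed.

(** The codomain is arbitrary so that the notion covers extended real functions, indicators, and
    also sets, seen as functions into [Prop]. *)
Definition periodic1 T (f : R -> T) :=
  forall (x : R) (m : int), f (x + m%:~R)%R = f x.

(** Let [m] be the floor of [c]. The windows from [c] to [c + 1] and from [m] to [m + 1] share the
    piece from [c] to [m + 1]; what remains of one is what remains of the other shifted by 1. *)
Lemma integral_uniform_translate (c : R) (f : R -> \bar R) :
  measurable_fun setT f -> (forall x, 0 <= f x) -> periodic1 f ->
  \int[U]_x f (x + c)%R = \int[U]_x f x.
Proof.
move=> mf f0 pf.
rewrite !integral_uniform01//; last first.
  by apply: measurableT_comp => //; exact: measurable_addr.
rewrite ge0_integral_translate// add0r (addrC 1%R c).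
have splitI (a b d : R) : (a <= b)%R -> (b <= d)%R ->
    \int[mu]_(x in `[a, d[) f x =
    \int[mu]_(x in `[a, b[) f x + \int[mu]_(x in `[b, d[) f x.
  move=> ab bd; rewrite (@itv_bndbnd_setU _ _ (BLeft a) (BLeft b) (BLeft d))//.
  rewrite ge0_integral_setU//; first exact: measurable_funTS.
  by apply/disj_setPS => x [/=]; rewrite !in_itv/= => /andP[_ xb] /andP[];
    rewrite leNgt xb.
have shiftI (m : int) (a b : R) :
    \int[mu]_(x in `[(a + m%:~R)%R, (b + m%:~R)%R[) f x =
    \int[mu]_(x in `[a, b[) f x.
  by rewrite -ge0_integral_translate//; apply: eq_integral => x _; rewrite pf.
pose m := Num.floor c.
have /andP[mc cm] := floor_itv c; rewrite -/m intrD in mc cm.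
rewrite -(shiftI m 0%R 1%R) add0r (addrC 1%R m%:~R).
rewrite (splitI m%:~R c)//; last exact: ltW.
rewrite (splitI c (m%:~R + 1)%R (c + 1)%R)//; [|exact: ltW|by rewrite lerD2r].
by rewrite addeC -(shiftI 1%R _ c).
Qed.

(* The left-hand side does not change when [x] is shifted by [s / k]; averaging
   over [s] and exchanging the integrals replaces the dilation by a translation. *)
Lemma integral_uniform_dilate (k : int) (c : R) (f : R -> \bar R) : k != 0%R ->
  measurable_fun setT f -> (forall x, 0 <= f x) -> periodic1 f ->
  \int[U]_x f (k%:~R * x + c)%R = \int[U]_x f x.
Proof.
move=> k0 mf f0 pf.
have mk s : measurable_fun setT (fun x : R => f (k%:~R * x + s)%R).
  apply: measurableT_comp => //.
  by apply: measurable_funD => //; exact: measurable_funM.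
have shiftk s : \int[U]_x f (k%:~R * x + s)%R = \int[U]_x f (k%:~R * x + 0)%R.
  rewrite -[RHS](@integral_uniform_translate (s / k%:~R)%R)//; last first.
    by move=> x m; rewrite mulrDr addrAC -intrM pf.
  apply: eq_integral => x _.
  by rewrite mulrDr addr0 mulrCA divff ?mulr1// intr_eq0.
rewrite shiftk.
transitivity (\int[U]_s \int[U]_x f (k%:~R * x + s)%R).
  under [RHS]eq_integral do rewrite shiftk.
  by rewrite integral_cst_probability.
rewrite (@fubini_tonelli _ _ _ _ _ U U
  (fun z : R * R => f (k%:~R * z.2 + z.1)%R))//=; last first.
  apply: measurableT_comp => //; apply: measurable_funD => //.
  by apply: measurable_funM.
under eq_integral do
  (under eq_integral do rewrite addrC; rewrite integral_uniform_translate//).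
by rewrite integral_cst_probability.
Qed.

End translation.

(** * Second Borel-Cantelli lemma for pairwise independent events *)

Section borel_cantelli.
Context d (T : measurableType d) (R : realType) (P : probability T R).
Context (E : nat -> set T) (mE : forall n, measurable (E n)).
Context (indepE : forall i j, (i < j)%N ->
  P (E i `&` E j) = (P (E i) * P (E j))%E).
Local Open Scope ereal_scope.

Let p i : R := fine (P (E i)).
Let pE i : P (E i) = (p i)%:E.
Proof. by rewrite fineK// fin_num_measure. Qed.
Let p_ge0 i : (0 <= p i)%R.
Proof. exact: fine_ge0. Qed.

(* Chebyshev's bound: with [S] the number of [i] in the range such that [E i]
   occurs and [s] its mean, integrate [s^2 1_C + 2 s S <= S^2 + s^2]. *)
Lemma indep_none_occurs_le (C : set T) (m n : nat) : measurable C ->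
  (forall i, (m <= i)%N -> C `&` E i = set0) ->
  ((\sum_(m <= i < n) fine (P (E i)))%R ^+ 2)%:E * P C <=
  (\sum_(m <= i < n) fine (P (E i)))%:E.
Proof.
move=> mC CE; set s := (\sum_(_ <= _ < _) _)%R.
have s_ge0 : (0 <= s)%R by apply: sumr_ge0 => i _; exact: p_ge0.
pose S x : R := (\sum_(m <= i < n) \1_(E i) x)%R.
have mS : measurable_fun setT S.
  by apply: measurable_sum => i; exact: measurable_indic.
have S_ge0 x : (0 <= S x)%R by apply: sumr_ge0 => i _; rewrite indicE ler0n.
have intS : \int[P]_x (S x)%:E = s%:E.
  rewrite /S; under eq_integral do rewrite -sumEFin.
  rewrite ge0_integral_sum//; first last.
  - by move=> i; exact/measurable_EFinP/measurable_indic.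
  rewrite /s -sumEFin; apply: eq_bigr => i _.
  by rewrite integral_indic// setIT; exact: pE.
have intSS : \int[P]_x (S x ^+ 2)%:E <= (s + s ^+ 2)%:E.
  have -> : \int[P]_x (S x ^+ 2)%:E =
      \sum_(m <= i < n) \sum_(m <= j < n) P (E i `&` E j).
    transitivity (\int[P]_x
        (\sum_(m <= i < n) \sum_(m <= j < n) (\1_(E i `&` E j) x)%:E)).
      apply: eq_integral => x _; rewrite expr2 /S mulr_suml -sumEFin.
      apply: eq_bigr => i _; rewrite mulr_sumr -sumEFin; apply: eq_bigr => j _.
      by rewrite indicI.
    rewrite ge0_integral_sum//; first last.
    - by move=> i x _; apply: sume_ge0 => j _; rewrite lee_fin indicE ler0n.
    - move=> i; apply: emeasurable_sum => j.
      by apply/measurable_EFinP/measurable_indic; exact: measurableI.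
    apply: eq_bigr => i _; rewrite ge0_integral_sum//; first last.
    - by move=> j; apply/measurable_EFinP/measurable_indic; exact: measurableI.
    apply: eq_bigr => j _.
    by rewrite integral_indic// ?setIT//; exact: measurableI.
  (* Row by row: the diagonal term is [p i], and by independence the others sum to at most
     [p i * s], the absent term [j = i] being nonnegative. *)
  rewrite expr2 {2}/s mulr_suml -big_split/= -sumEFin.
  rewrite !big_seq; apply: lee_sum => i; rewrite mem_index_iota => imn.
  rewrite (bigD1_seq i)/= ?mem_index_iota ?iota_uniq// setIid EFinD pE leeD2l//.
  rewrite EFinM /s -sumEFin ge0_sume_distrr; last first.
    by move=> j _; rewrite lee_fin p_ge0.
  rewrite big_mkcond/=; apply: lee_sum => j _.
  case: eqVneq => /= [_|ij]; first by rewrite mule_ge0// lee_fin p_ge0.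
  rewrite -!/(p _) -!pE.
  have [ji|ji|/eqP] := ltngtP j i; last by rewrite (negbTE ij).
  - by rewrite setIC indepE// muleC.
  - by rewrite indepE.
have : \int[P]_x ((s ^+ 2 * \1_C x + 2 * s * S x)%:E) <=
       \int[P]_x ((S x ^+ 2 + s ^+ 2)%:E).
  apply: ge0_le_integral => //=.
  - by move=> x _; rewrite lee_fin addr_ge0// mulr_ge0// ?sqr_ge0// mulr_ge0.
  - apply/measurable_EFinP/measurable_funD; first by exact: measurable_funM.
    exact: measurable_funM.
  - by apply/measurable_EFinP/measurable_funD => //; exact: measurable_funX.
  (* Off [C] the inequality says that [(S x - s) ^+ 2] is nonnegative; on [C] none of the events
     occurs, so [S x] is 0. *)
  - move=> x _; rewrite lee_fin indicE.
    case: (boolP (x \in C)) => xC /=; last first.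
      rewrite mulr0 add0r -subr_ge0.
      have -> : (S x ^+ 2 + s ^+ 2 - 2 * s * S x = (S x - s) ^+ 2)%R.
        by ring.
      exact: sqr_ge0.
    suff -> : S x = 0%R by rewrite !mulr0 mulr1 addr0 expr0n/= add0r.
    rewrite /S big_seq big1// => i; rewrite mem_index_iota => /andP[mi _].
    rewrite indicE memNset// => Ex.
    have : (C `&` E i) x by split => //; exact: set_mem.
    by rewrite CE.
under eq_integral do rewrite EFinD.
under [in leRHS]eq_integral do rewrite EFinD.
rewrite ge0_integralD//=; first last.
- by apply/measurable_EFinP; exact: measurable_funM.
- by move=> x _; rewrite lee_fin mulr_ge0// mulr_ge0.
- by apply/measurable_EFinP; exact: measurable_funM.
- by move=> x _; rewrite lee_fin mulr_ge0// ?sqr_ge0// indicE ler0n.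
rewrite ge0_integralD//=; first last.
- by move=> x _; rewrite lee_fin sqr_ge0.
- by apply/measurable_EFinP; exact: measurable_funX.
- by move=> x _; rewrite lee_fin sqr_ge0.
under eq_integral do rewrite EFinM.
rewrite ge0_integralZl//; first last.
- by rewrite lee_fin sqr_ge0.
- exact/measurable_EFinP/measurable_indic.
under [X in _ + X <= _]eq_integral do rewrite EFinM.
rewrite (@ge0_integralZl _ _ _ P _ _ (EFin \o S))//=; first last.
- by rewrite lee_fin mulr_ge0.
- by move=> x _; rewrite lee_fin.
- exact/measurable_EFinP.
have -> : \int[P]_x (\1_C x)%:E = P C by rewrite integral_indic// setIT.
rewrite intS integral_cst_probability.
(* The left side is [s ^+ 2 * P C + 2 * s ^+ 2] and the right side at most [s + 2 * s ^+ 2], so the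
   terms [2 * s ^+ 2] cancel. *)
move=> /le_trans/(_ (leeD intSS (le_refl _))).
have -> : P C = (fine (P C))%:E by rewrite fineK// fin_num_measure.
by rewrite -!EFinM -!EFinD !lee_fin; lra.
Qed.

(** The complement of [lim_sup_set E] is the union over [m] of the events [C] that no [E i] with
    [i >= m] occurs. Chebyshev's bound gives [P C <= s^-1] for every positive partial sum [s]
    started at [m], and these sums are unbounded. *)
Lemma indep_borel_cantelli :
  \sum_(n <oo) P (E n) = +oo -> P (lim_sup_set E) = 1.
Proof.
move=> sumE.
have mL : measurable (lim_sup_set E).
  by apply: bigcapT_measurable => k; exact: bigcup_measurable.
suff PL : P (~` lim_sup_set E) = 0.
  rewrite -[lim_sup_set E]setCK probability_setC ?PL ?sube0//.
  exact: measurableC.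
apply/negligibleP; first exact: measurableC.
rewrite setC_bigcap; apply: negligible_bigcup => m.
rewrite setC_bigcup; set C := \bigcap_(_ in _) _.
have mC : measurable C.
  by apply: bigcap_measurableType => k _; exact: measurableC.
apply/negligibleP => //.
apply/eqP; rewrite eq_le measure_ge0 andbT; apply/lee_addgt0Pr => e e0.
rewrite add0e.
(* Divergence survives the removal of the first [m] terms, whose sum is finite. *)
have : \sum_(m <= i < n) P (E i) @[n --> \oo] --> +oo.
  have h0 i : (m <= i)%N -> true -> 0 <= P (E i) by [].
  rewrite -(_ : \sum_(m <= i <oo) P (E i) = +oo); first exact: is_cvg_nneseries.
  have := sumE; rewrite (nneseries_split 0 m)// add0n.
  have -> : \sum_(0 <= k < m) P (E k) = (\sum_(0 <= k < m) p k)%:E.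
    by rewrite -sumEFin; apply: eq_bigr.
  by case: (\sum_(m <= i <oo) _).
(* A partial sum of at least [e^-1] makes the bound [s^-1] at most [e]. *)
move=> /cvgeyPge/(_ (e^-1)%R) [n _ /(_ n (leqnn n))/=].
have -> : \sum_(m <= i < n) P (E i) = (\sum_(m <= k < n) fine (P (E k)))%:E.
  by rewrite -sumEFin; apply: eq_bigr => i _; rewrite -/(p i).
set s := (\sum_(_ <= _ < _) _)%R; rewrite lee_fin => es.
have s0 : (0 < s)%R by rewrite (lt_le_trans _ es)// invr_gt0.
have := @indep_none_occurs_le C m n mC; rewrite -/s.
have CE i : (m <= i)%N -> C `&` E i = set0.
  by move=> mi; apply/seteqP; split => // x [/(_ i mi)].
move=> /(_ CE).
have -> : P C = (fine (P C))%:E by rewrite fineK// fin_num_measure.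
rewrite -EFinM !lee_fin expr2 -mulrA ger_pMr// => h.
rewrite (le_trans _ (_ : s^-1 <= e)%R)//.
  by rewrite -[leRHS]mul1r ler_pdivlMr// mulrC.
by rewrite -[leRHS]invrK lef_pV2// ?posrE// invr_gt0.
Qed.

End borel_cantelli.

(** * Independence of periodic events on the torus *)

Section independence.
Context {R : realType}.
Local Notation mu := (@lebesgue_measure R).
Local Notation U := (uniform_prob (@ltr01 R)).
Local Open Scope ereal_scope.

Lemma uniform01E (A : set R) : measurable A -> U A = mu (A `&` `[0%R, 1%R]).
Proof.
move=> mA; transitivity (\int[U]_x (\1_A x)%:E).
  by rewrite integral_indic// setIT.
rewrite integral_uniform//; last exact/measurable_EFinP/measurable_indic.
by rewrite subr0 invr1 mul1e integral_indic.
Qed.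

Lemma measurable_intr_subr (a : int) :
  measurable_fun [set: R * R] (fun z : R * R => a%:~R * z.1 - z.2)%R.
Proof. by apply: measurable_funB => //; exact: measurable_funM. Qed.

Lemma measurable_preimage_intr_subr (a : int) (A : set R) : measurable A ->
  measurable [set z : R * R | A (a%:~R * z.1 - z.2)%R].
Proof.
move=> mA; rewrite -[X in measurable X]setTI.
exact: (measurable_intr_subr a measurableT mA).
Qed.

(** For fixed [x], translating [y] by [a x] turns the two arguments into [- y] and [k x - y] with
    [k = b - a] nonzero. Integrating over [x] first, the dilation by [k] makes the second factor
    contribute [U B] whatever [y] is, and [U A] is left for the integral over [y]. *)
Lemma periodic_sets_indep (a b : int) (A B : set R) : a != b ->
  measurable A -> measurable B -> periodic1 A -> periodic1 B ->
  (U \x U) ([set z : R * R | A (a%:~R * z.1 - z.2)%R] `&`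
            [set z : R * R | B (b%:~R * z.1 - z.2)%R]) = U A * U B.
Proof.
move=> ab mA mB pA pB.
have mDA := measurable_preimage_intr_subr a mA.
have mDB := measurable_preimage_intr_subr b mB.
have indicP C : periodic1 C -> periodic1 (\1_C : R -> R).
  move=> pC x m; rewrite !indicE; congr (_%:R); congr nat_of_bool.
  by apply/idP/idP; rewrite !inE pC.
pose g (s : R) (t : R) : \bar R := (\1_A s * \1_B t)%:E.
have mg (f1 f2 : R * R -> R) :
    measurable_fun setT f1 -> measurable_fun setT f2 ->
    measurable_fun setT (fun z => g (f1 z) (f2 z)).
  move=> mf1 mf2; apply/measurable_EFinP; apply: measurable_funM.
    by apply: measurableT_comp => //; exact: measurable_indic.
  by apply: measurableT_comp => //; exact: measurable_indic.
have g0 s t : 0 <= g s t by rewrite lee_fin mulr_ge0.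
transitivity (\int[U]_x \int[U]_y g (a%:~R * x - y)%R (b%:~R * x - y)%R).
  rewrite -(@fubini_tonelli1 _ _ _ _ _ U U
    (fun z : R * R => g (a%:~R * z.1 - z.2)%R (b%:~R * z.1 - z.2)%R))//;
    last first.
    by apply: mg; exact: measurable_intr_subr.
  transitivity (\int[U \x U]_z
     (\1_([set z : R * R | A (a%:~R * z.1 - z.2)%R] `&`
            [set z : R * R | B (b%:~R * z.1 - z.2)%R]) z)%:E).
    by rewrite integral_indic ?setIT//; exact: measurableI.
  by apply: eq_integral => z _; rewrite indicI.
pose k : int := (b - a)%R.
have k0 : k != 0%R by rewrite subr_eq0 eq_sym.
transitivity (\int[U]_x \int[U]_y g (- y)%R (k%:~R * x - y)%R).
  apply: eq_integral => x _.
  rewrite -(@integral_uniform_translate _ (a%:~R * x)%R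
    (fun y => g (a%:~R * x - y)%R (b%:~R * x - y)%R))//.
  - apply: eq_integral => y _; congr (g _ _); first by ring.
    by rewrite /k intrB; ring.
  - have := mg _ _ (measurable_intr_subr a) (measurable_intr_subr b).
    exact: measurable_fun_pair2.
  - move=> y m; rewrite /g.
    rewrite -(indicP _ pA _ m) -(indicP _ pB _ m).
    by congr (_ * _)%:E; congr (\1_ _ _); ring.
rewrite (@fubini_tonelli _ _ _ _ _ U U
  (fun z : R * R => g (- z.2)%R (k%:~R * z.1 - z.2)%R))//=; last first.
  by apply: mg; [exact: measurableT_comp|exact: measurable_intr_subr].
have intI C : measurable C -> \int[U]_x (\1_C x)%:E = U C.
  by move=> mC; rewrite integral_indic// setIT.
transitivity (\int[U]_y (U B * (\1_A (- y)%R)%:E)).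
  apply: eq_integral => y _; under eq_integral do rewrite /g EFinM.
  rewrite ge0_integralZl//; last first.
    apply/measurable_EFinP; apply: measurableT_comp => //.
    by apply: measurable_funB => //; exact: measurable_funM.
  rewrite muleC; congr (_ * _); rewrite -intI//.
  rewrite (@integral_uniform_dilate R k (- y)%R (EFin \o \1_B))//.
  - exact/measurable_EFinP/measurable_indic.
  - by move=> x; rewrite /= lee_fin.
  - by move=> x m; rewrite /= indicP.
rewrite ge0_integralZl//; last first.
  by apply/measurable_EFinP; apply: measurableT_comp => //.
rewrite muleC; congr (_ * _); rewrite -intI//.
(* The reflection of [y] is the dilation by [-1]. *)
rewrite -(@integral_uniform_dilate R (-1)%R 0%R (EFin \o \1_A))//.
- by apply: eq_integral => y _ /=; rewrite addr0 mulN1r.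
- exact/measurable_EFinP/measurable_indic.
- by move=> x; rewrite /= lee_fin.
- by move=> x m; rewrite /= indicP.
Qed.

End independence.

(** If the sum of [v] were finite, its tail from some [N] on would be below 1. Each later [v n]
    would then be below 1, forcing the minimum to be [u n], and [u] would be summable by
    comparison. *)
Lemma nneseries_minr1_pinfty (R : realType) (u : nat -> R) (v : nat -> \bar R) :
  (forall n, 0 <= u n) -> (forall n, (Num.min (u n) 1)%:E <= v n)%E ->
  (\sum_(n <oo) (u n)%:E = +oo)%E -> (\sum_(n <oo) v n = +oo)%E.
Proof.
move=> u0 uv sumu; apply/eqP; rewrite -leye_eq leNgt; apply/negP => sumv.
have v0 n : (0 <= v n)%E.
  by apply: le_trans (uv n); rewrite lee_fin le_min u0 ler01.
have [N tailN] : exists N, (\sum_(N <= k <oo) v k < 1)%E.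
  have /fine_cvgP[tail_fin tail0] := nneseries_tail_cvg sumv (fun k _ => v0 k).
  have [N _ /(_ N (leqnn N))[tN]] := filterI tail_fin (cvgr_lt _ tail0 _ ltr01).
  by move=> tN1; exists N; rewrite -(fineK tN) lte_fin.
have uvN n : (N <= n)%N -> ((u n)%:E <= v n)%E.
  move=> Nn; have vn1 : (v n < 1)%E.
    apply: le_lt_trans tailN.
    rewrite (le_trans _ (nneseries_lim_ge n.+1 _))//.
    by rewrite big_nat_recr//= leeDr// sume_ge0.
  have := uv n; rewrite minEle; case: ifPn => // _ v1.
  by have := le_lt_trans v1 vn1; rewrite ltxx.
have : (\sum_(n <oo) (u n)%:E < +oo)%E.
  rewrite (nneseries_split 0 N) => [|k _]; last by rewrite lee_fin.
  rewrite add0n sumEFin lte_add_pinfty ?ltry//.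
  apply: le_lt_trans (lt_trans tailN (ltry 1)).
  apply: lee_lim => //.
  - by apply: is_cvg_nneseries => k _ _; rewrite lee_fin.
  - exact: is_cvg_nneseries.
  - by apply: nearW => n; rewrite !big_nat; apply: lee_sum => k /andP[Nk _];
      exact: uvN.
by rewrite sumu ltxx.
Qed.

(** * Points at distance less than [r] from the integers *)

Section dist_int_sublevel.
Context {R : realType}.
Local Notation mu := (@lebesgue_measure R).
Local Notation U := (uniform_prob (@ltr01 R)).

(** The infimum of a nonempty set bounded below is strictly less than [r] exactly when some member
    is. *)
Lemma dist_int_ltP (x r : R) :
  dist_int x < r <-> exists m : int, `|x - m%:~R| < r.
Proof.
split=> [|[m xm]].
  move=> /inf_lt[|_ [m _ <-] xm]; last by exists m.
  by exists `|x - 0%:~R|; exists 0.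
apply: le_lt_trans xm; apply: ge_inf; last by exists m.
by exists 0 => _ [k _ <-].
Qed.

Lemma periodic1_dist_int_lt (r : R) : periodic1 [set x : R | dist_int x < r].
Proof.
move=> x m; apply/propext; split => /dist_int_ltP[k xk]; apply/dist_int_ltP.
  by exists (k - m); rewrite intrB opprB addrA.
by exists (k + m); rewrite intrD opprD addrACA subrr addr0.
Qed.

Lemma measurable_dist_int_lt (r : R) : measurable [set x : R | dist_int x < r].
Proof.
rewrite (_ : [set x | _] = \bigcup_(m : int) ball (m%:~R : R) r); last first.
  apply/seteqP; split => [x /dist_int_ltP[m xm]|x [m _ xm]].
    by exists m => //; rewrite /ball/= distrC.
  by apply/dist_int_ltP; exists m; rewrite distrC.
apply: open_measurable; apply: bigcup_open => m _; exact: ball_open.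
Qed.

(** On the interval from 0 to [Num.min r 1], right end excluded, the integer 0 is already within
    distance [r]. *)
Lemma uniform01_dist_int_lt (r : R) : 0 <= r ->
  ((Num.min r 1)%:E <= U [set x : R | (dist_int x < r)%R])%E.
Proof.
move=> r0; rewrite uniform01E; last exact: measurable_dist_int_lt.
have q0 : 0 <= Num.min r 1 by rewrite le_min r0 ler01.
apply: (@le_trans _ _ (mu `[0, Num.min r 1[)).
  rewrite lebesgue_measure_itv/= lte_fin sube0.
  by case: ltP => // q0'; rewrite lee_fin.
apply: le_measure; rewrite ?inE//.
  by apply: measurableI => //; exact: measurable_dist_int_lt.
move=> x/=; rewrite !in_itv/= lt_min => /andP[x0 /andP[xr x1]]; split.
  by apply/dist_int_ltP; exists 0; rewrite subr0 ger0_norm.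
by rewrite x0 ltW.
Qed.

End dist_int_sublevel.

(** Translates the infinitely many positive indices of [W] into the form of a [lim_sup_set] whose
    events are numbered from 0. *)
Lemma infinite_setS_natP (Q : nat -> Prop) :
  infinite_set [set n | (1 <= n)%N /\ Q n] <->
  forall N, exists2 j, (N <= j)%N & Q j.+1.
Proof.
split=> [infQ N|Qoo /finite_seqP[s Qs]].
  apply: contrapT => nQ; apply: infQ.
  apply: (@sub_finite_set _ _ `I_N.+1) => //.
  move=> [|n] [//= _ Qn]; rewrite ltnS ltnNge; apply/negP => Nn.
  by apply: nQ; exists n.
(* If [s] listed all the indices, this [j.+1] would be in the list and exceed its maximum. *)
have [j jN Qj] := Qoo (\max_(i <- s) i)%N.
have : [set` s] j.+1 by rewrite -Qs.
move=> /= js; have := @leq_bigmax_seq _ s xpredT id _ js erefl.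
by rewrite leqNgt ltnS jN.
Qed.

(** * Borel-Cantelli on the unit square, then Fubini *)

Theorem theorem1p2 (R : realType) (a : nat -> int) (psi : nat -> R)
    (a_incr : forall m n : nat, (1 <= m)%N -> (m < n)%N -> a m < a n)
    (psi_ge0 : forall n : nat, (1 <= n)%N -> 0 <= psi n)
    (psi_div : (\sum_(1 <= n <oo) (psi n)%:E = +oo)%E) :
  {ae (@lebesgue_measure R), forall alpha : R, alpha \in `[0, 1] ->
    lebesgue_measure (W psi a alpha) = 1%E}.
Proof.
pose U := uniform_prob (@ltr01 R).
(* The index is shifted by one: [lim_sup_set] counts from 0, the hypotheses on [a] and [psi] from
   1. *)
pose B n : set R := [set x | dist_int x < psi n.+1].
pose E n : set (R * R) := [set z | B n ((a n.+1)%:~R * z.1 - z.2)].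
have mB n : measurable (B n) by exact: measurable_dist_int_lt.
have pB n : periodic1 (B n) by exact: periodic1_dist_int_lt.
have mE n : @measurable _ (measurableTypeR R * measurableTypeR R)%type (E n).
  exact: measurable_preimage_intr_subr.
have PE n : (U \x U)%E (E n) = U (B n).
  (* The probability of a single event is the independence formula with the whole line as second
     set; [a n.+2] serves as an integer other than [a n.+1]. *)
  have a_neq : a n.+1 != a n.+2 by rewrite lt_eqF// a_incr.
  have pT : periodic1 [set: R] by [].
  have := periodic_sets_indep a_neq (mB n) measurableT (pB n) pT.
  rewrite [X in (_ `&` X)](_ : _ = setT)// setIT => ->.
  by rewrite [X in (_ * X)%E]probability_setT mule1.
have indepE i j : (i < j)%N ->
    (U \x U)%E (E i `&` E j) = ((U \x U)%E (E i) * (U \x U)%E (E j))%E.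
  move=> ij; rewrite !PE periodic_sets_indep//.
  by rewrite lt_eqF// a_incr.
have sumE : (\sum_(n <oo) (U \x U)%E (E n) = +oo)%E.
  apply: (@nneseries_minr1_pinfty _ (fun n => psi n.+1)).
  - by move=> n; exact: psi_ge0.
  - by move=> n; rewrite PE; apply: uniform01_dist_int_lt; exact: psi_ge0.
  - rewrite -psi_div.
    (* [n.-1.+1] is [n] for positive [n], and at 0 it avoids [psi 0], whose sign is unknown. *)
    transitivity (\sum_(1 <= n <oo) (psi n.-1.+1)%:E)%E.
      rewrite -(@nneseries_addn _ (fun n => (psi n.-1.+1)%:E))//.
        by apply: eq_eseriesr => n _; rewrite addn1.
      by move=> n; rewrite lee_fin psi_ge0.
    by congr (limn _); apply/funext => n; apply: eq_big_nat => -[].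
pose P : probability (measurableTypeR R * measurableTypeR R)%type R :=
  (U \x U)%E.
have PL : P (lim_sup_set E) = 1%E :=
  @indep_borel_cantelli _ _ R P E mE indepE sumE.
set L := lim_sup_set E in PL.
have mL : @measurable _ (measurableTypeR R * measurableTypeR R)%type L.
  by apply: bigcapT_measurable => k; exact: bigcup_measurable.
have PLC : P (~` L) = 0%E by rewrite probability_setC// PL subee.
have mUL : measurable_fun setT (fun x => U (xsection (~` L) x)).
  by apply: measurable_fun_xsection; exact: measurableC.
(* The integral of the measures of the sections is the product measure of the complement of [L],
   namely 0, so the nonnegative integrand vanishes almost everywhere. *)
have : ae_eq (@lebesgue_measure R) (`[0, 1]%classic : set R)
    (fun x => U (xsection (~` L) x)) (cst 0%E).
  apply/ae_eq_integral_abs => //; first exact: measurable_funTS.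
  have : (\int[uniform_prob (@ltr01 R)]_x U (xsection (~` L) x) = 0)%E.
    exact: PLC.
  rewrite integral_uniform// subr0 invr1 mul1e => intUL.
  by rewrite -[RHS]intUL; apply: eq_integral => x _; rewrite gee0_abs.
apply: filterS => alpha /= + alpha01 => /(_ alpha01) UL0.
(* Cutting with the unit interval turns Lebesgue measure into [U], for which the section of [L] has
   a null complement. *)
have -> : W psi a alpha = xsection L alpha `&` `[0, 1].
  apply/seteqP; split => gamma /=.
    move=> [gamma01 /infinite_setS_natP Woo]; split => //.
    rewrite /xsection/= inE => N _; have [j Nj Wj] := Woo N.
    by exists j.
  rewrite /xsection/= inE => -[Lg gamma01]; split => //.
  apply/infinite_setS_natP => N; have [j Nj Ej] := Lg N I.
  by exists j.
rewrite -uniform01E; last exact: measurable_xsection.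
have -> : xsection L alpha = ~` xsection (~` L) alpha.
  apply/seteqP; split => y; rewrite /xsection/= !inE; first by move=> Ly; apply.
  exact: contrapT.
rewrite [LHS]probability_setC; last first.
  by apply: measurable_xsection; exact: measurableC.
by rewrite [X in (_ - X)%E]UL0 sube0.
Qed.
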